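(* Let $\mathcal{X}=(X,d_X,f_X)$ be a finite augmented metric space, let $\mathcal{I}_{\mathcal{X}}=\{\!\{I_x:x\in X\}\!\}$ be an elder-rule-staircode of $\mathcal{X}$, and let $\gamma_0^{\mathcal{X}},\gamma_1^{\mathcal{X}},\gamma_2^{\mathcal{X}}$ be the associated elder-rule feature functions. Let $\theta_{\mathcal{X}}^{\mathrm{bi}}$ be the Rips bipersistence treegram of $\mathcal{X}$. Then for each $\mathbf{a}\in\mathbb{R}^2$, $$|\theta_{\mathcal{X}}^{\mathrm{bi}}(\mathbf{a})| = \#\{x\in X:\mathbf{a}\in I_x\} = \sum_{\mathbf{x}\le\mathbf{a}}\ \sum_{j=0}^{2}(-1)^j\gamma_j^{\mathcal{X}}(\mathbf{x}),$$ where $|\theta_{\mathcal{X}}^{\mathrm{bi}}(\mathbf{a})|$ is the number of blocks of the sub-partition $\theta_{\mathcal{X}}^{\mathrm{bi}}(\mathbf{a})$.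
   Context: **Setting.** A finite augmented metric space is a triple $\mathcal{X}=(X,d_X,f_X)$ with $(X,d_X)$ a finite metric space and $f_X:X\to\mathbb{R}$. Put $X_\sigma=\{x\in X:f_X(x)\le\sigma\}$. The Rips complex $\mathcal{R}_\varepsilon(X_\sigma,d_X)$ has as simplices the nonempty $A\subseteq X_\sigma$ with $d_X(a,a')\le\varepsilon$ for all $a,a'\in A$ (empty if $\varepsilon<0$). For a simplicial complex $K$, $\pi_0(K)$ is the partition of its vertex set into connected components (the partition of the empty set is the empty set). The Rips bipersistence treegram is $\theta_{\mathcal{X}}^{\mathrm{bi}}(\sigma,\varepsilon)=\pi_0(\mathcal{R}_\varepsilon(X_\sigma,d_X))$ for $(\sigma,\varepsilon)\in\mathbb{R}^2$. $\mathbb{R}^2$ carries the product order. **Elder-rule-staircode.** For $\varepsilon\ge 0$ and $x\in X_\sigma$, $[x]_{(\sigma,\varepsilon)}$ is the set of all $x'\in X_\sigma$ joined to $x$ by a sequence in $X_\sigma$ with consecutive distances $\le\varepsilon$. A total order $<$ on $X$ is compatible with $f_X$ if $f_X(x)<f_X(x')$ implies $x<x'$. For a compatible order, $I_x:=\{(\sigma,\varepsilon)\in\mathbb{R}^2:\varepsilon\ge0,\ x\in X_\sigma,\ x=\min([x]_{(\sigma,\varepsilon)},<)\}$, and $\{\!\{I_x:x\in X\}\!\}$ is an elder-rule-staircode of $\mathcal{X}$. **Corner points and feature functions.** Let $I\subseteq\mathbb{R}^2$ be one of the sets $I_x$, with indicator function $\mathbf{1}_I$. For $\mathbf{a}\in\mathbb{R}^2$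 let $l=\lim_{t\to0+}\mathbf{1}_I(\mathbf{a}-(t,0))$, $b=\lim_{t\to0+}\mathbf{1}_I(\mathbf{a}-(0,t))$, $d=\lim_{t\to0+}\mathbf{1}_I(\mathbf{a}-(t,t))$. Then $\mathbf{a}$ is a $0$-th type corner point of $I$ if $\mathbf{1}_I(\mathbf{a})=1$ and $l=b=d=0$; a $1$-st type corner point if $\mathbf{1}_I(\mathbf{a})-l-b+d=-1$; a $2$-nd type corner point if $\mathbf{1}_I(\mathbf{a})=0$, $l=b=0$ and $d=1$. Let $\gamma_j(I)(\mathbf{a})=1$ if $\mathbf{a}$ is a $j$-th type corner point of $I$ and $0$ otherwise. The $j$-th elder-rule feature function is $\gamma_j^{\mathcal{X}}=\sum_{x\in X}\gamma_j(I_x):\mathbb{R}^2\to\mathbb{Z}_{\ge0}$ (finitely supported). *)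

(* Defs.v *)
From HB Require Import structures.
From mathcomp Require Import all_boot all_order all_algebra.
From mathcomp Require Import all_classical all_reals all_analysis.

Set Implicit Arguments.
Unset Strict Implicit.
Unset Printing Implicit Defensive.

Import Order.TTheory GRing.Theory Num.Theory.
Import numFieldNormedType.Exports.

Local Open Scope classical_set_scope.
Local Open Scope ring_scope.

(* [finMetricType R] joins [finType] with the library's [metricType R] (whose
   distance is [mdist]).  An augmented metric space is such an X together with
   a function f : X -> R. *)
#[short(type="finMetricType")]
HB.structure Definition FinMetric (K : numDomainType) :=
  { M of Finite M & Metric K M }.

Section SimplicialComplex.
Variable T : finType.
Implicit Type K : {set {set T}}.

Definition vertices K : {set T} := [set x | [set x]%SET \in K]%SET.

Definition adjacent K : rel T := fun x y => [set x; y]%SET \in K.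

Definition pi0 K : {set {set T}} :=
  equivalence_partition (connect (adjacent K)) (vertices K).

End SimplicialComplex.

Section Treegram.
Variables (R : realType) (X : finMetricType R).
Implicit Types (f : X -> R) (lt : rel X) (a : R * R).

Definition sublevel f (sigma : R) : {set X} := [set x | f x <= sigma]%SET.

(* For eps < 0 this is empty since mdist x x = 0. *)
Definition rips (eps : R) (S : {set X}) : {set {set X}} :=
  [set A : {set X} | [&& A != finset.set0, A \subset S &
     [forall x in A, forall y in A, mdist x y <= eps]]]%SET.

Definition rips_treegram f a : {set {set X}} :=
  pi0 (rips a.2 (sublevel f a.1)).

Definition step f a : rel X := fun y z =>
  [&& y \in sublevel f a.1, z \in sublevel f a.1 & mdist y z <= a.2].

(* [connect] is reflexive, which accounts for the one-term sequences. *)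
Definition chain_class f a (x : X) : {set X} :=
  [set y in sublevel f a.1 | connect (step f a) x y]%SET.

Definition strict_total_order lt : Prop :=
  [/\ irreflexive lt, transitive lt & forall x y, x != y -> lt x y || lt y x].

Definition compatible f lt : Prop := forall x y, f x < f y -> lt x y.

Definition is_min lt (A : {set X}) (x : X) : Prop :=
  x \in A /\ forall y, y \in A -> y != x -> lt x y.

(* The elder-rule-staircode is the family x |-> staircase f lt x. *)
Definition staircase f lt (x : X) : set (R * R) :=
  [set a | [/\ 0 <= a.2, x \in sublevel f a.1
             & is_min lt (chain_class f a x) x]].

End Treegram.

Section CornerPoints.
Variable R : realType.
Implicit Types (I : set (R * R)) (a : R * R).

Definition left_limit I a : R :=
  lim ((\1_I (a - (t, 0)) : R) @[t --> 0^'+]).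

Definition below_limit I a : R :=
  lim ((\1_I (a - (0, t)) : R) @[t --> 0^'+]).

Definition diag_limit I a : R :=
  lim ((\1_I (a - (t, t)) : R) @[t --> 0^'+]).

Definition corner_point (j : nat) I a : Prop :=
  let v : R := \1_I a in
  let l := left_limit I a in
  let b := below_limit I a in
  let d := diag_limit I a in
  match j with
  | 0%N => [/\ v = 1, l = 0, b = 0 & d = 0]
  | 1%N => v - l - b + d = -1
  | 2%N => [/\ v = 0, l = 0, b = 0 & d = 1]
  | _ => False
  end.

Definition corner_indicator (j : nat) I a : nat := `[< corner_point j I a >].

End CornerPoints.

Definition feature (R : realType) (X : finMetricType R) (f : X -> R)
    (lt : rel X) (j : nat) (a : R * R) : nat :=
  (\sum_(x : X) corner_indicator j (staircase f lt x) a)%N.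

Definition down_set (R : realType) (a : R * R) : set (R * R) :=
  [set p | p.1 <= a.1 /\ p.2 <= a.2].

(* Main.v *)
(* Blocks of the treegram at a correspond to their lt-minimal points, which are
   the x with a in I_x.  Membership of (sigma, eps) in I_x depends only on the
   finite sets [f <= sigma] and [mdist <= eps], and the one-sided limits at a
   replace either inequality by a strict one.  Since I_x is closed under
   decreasing (sigma, eps) above its corner (f x, 0), the possible values of
   1_I(a), l, b, d are restricted enough that
   gamma_0 - gamma_1 + gamma_2 = 1_I(a) - l - b + d at every point, and the sum
   of these mixed differences over the down-set of a telescopes to 1_I(a). *)
Require Import Defs.
From mathcomp Require Import all_boot all_order all_algebra.
From mathcomp Require Import all_classical all_reals all_analysis.
From mathcomp Require Import lra.

Set Implicit Arguments.
Unset Strict Implicit.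
Unset Printing Implicit Defensive.

Import Order.TTheory GRing.Theory Num.Theory.
Import numFieldNormedType.Exports.

Local Open Scope ring_scope.

(** * Telescoping over the finitely many values of a function *)

Section Telescoping.
Variables (R : realType) (T : finType) (h : T -> R).

Definition le_set (r : R) : {set T} := [set y | h y <= r]%SET.
Definition lt_set (r : R) : {set T} := [set y | h y < r]%SET.

Lemma lt_sub_le_set r : lt_set r \subset le_set r.
Proof. by apply/fintype.subsetP => y; rewrite !inE => /ltW. Qed.

Lemma le_set_jump r : le_set r != lt_set r -> exists y, h y = r.
Proof.
move=> neq; apply: contrapT => nex; move/eqP: neq; apply.
apply/finset.setP => y.
by rewrite !inE le_eqVlt; case: eqP => //= e; case: nex; exists y.
Qed.

(** For a single [y], [h y <= r - t] agrees with [h y < r] once [t > 0] is small; finiteness of [T]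
    gives one range of [t] for all [y]. *)
Lemma near_le_set r : \forall t \near (0^'+)%classic, le_set (r - t) = lt_set r.
Proof.
have : \forall t \near (0^'+)%classic, forall y, (h y <= r - t) = (h y < r).
  apply: filter_forall => y; have [lyr|lry] := ltP (h y) r.
    near=> t; rewrite lerBrDr -lerBrDl; apply/ltW.
    by near: t; apply: nbhs_right_lt; rewrite subr_gt0.
  near=> t; apply/negbTE; rewrite -ltNge ltrBlDr.
  by rewrite (le_lt_trans lry)// ltrDl; near: t; exact: nbhs_right_gt.
by apply: filterS => t H; apply/finset.setP => y; rewrite !inE H.
Unshelve. all: by end_near. Qed.

(** Only values of [h] contribute, and just below one value the sublevel set is that of the
    preceding value. A down-closed [P] covers both [p <= c] and [p < c], so induction can remove the
    largest value satisfying [P]. *)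
Lemma telescope_le_set (V : zmodType) (H : {set T} -> V) (s : seq R)
    (P : pred R) : uniq s -> (forall y, h y \in s) ->
    (forall p q, p <= q -> P q -> P p) ->
  \sum_(p <- s | P p) (H (le_set p) - H (lt_set p)) =
  H [set y | P (h y)]%SET - H finset.set0.
Proof.
move=> us hs; have [n] := ubnP #|[set y | P (h y)]%SET|.
elim: n P => // n IHn P /ltnSE leSn Pdown.
case: (pickP (fun y => P (h y))) => [y0 Py0|P0]; last first.
  have -> : [set y | P (h y)]%SET = finset.set0.
    by apply/finset.setP => y; rewrite !inE P0.
  rewrite subrr big1 // => p Pp.
  have [->|/le_set_jump[y hy]] := eqVneq (le_set p) (lt_set p).
    by rewrite subrr.
  by have := P0 y; rewrite /= hy Pp.
case: (@Order.TotalTheory.arg_maxP _ _ _ y0 (fun y => P (h y)) h Py0).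
move=> m /= Pm mmax.
have E : [set y | P (h y)]%SET = le_set (h m).
  apply/finset.setP => y; rewrite !inE; apply/idP/idP; first exact: mmax.
  by move=> /Pdown; apply.
rewrite E -big_filter (bigD1_seq (h m)) ?mem_filter ?Pm ?hs ?filter_uniq //=.
rewrite big_filter_cond (bigID (fun p => p < h m)) /=.
(* A nonzero term at such a [p] would make [p] a value of [h] satisfying [P] and exceeding the
   maximum [h m]. *)
rewrite [X in _ + (_ + X)]big1 ?addr0; last first.
  move=> p /andP[/andP[Pp ne] /negbTE nlt].
  have [->|/le_set_jump[y hy]] := eqVneq (le_set p) (lt_set p).
    by rewrite subrr.
  have := mmax y; rewrite hy => /(_ Pp) lep.
  by move: nlt; rewrite lt_neqAle ne lep.
rewrite (eq_bigl (fun p => p < h m)); last first.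
  move=> p; have [pm|] := ltP p (h m); last by rewrite andbF.
  by rewrite (lt_eqF pm) (Pdown _ _ (ltW pm) Pm).
rewrite IHn; first by rewrite -/(lt_set (h m)) addrA subrK.
- apply: leq_trans leSn; apply: proper_card.
  rewrite E; apply/properP; split; first exact: lt_sub_le_set.
  by exists m; rewrite !inE ?ltxx.
- by move=> p q pq /(le_lt_trans pq).
Qed.

End Telescoping.

(** The mixed difference is a difference of differences, supported on pairs of values of [h] and
    [k], so the sum is finite and telescopes in each variable; the boundary terms are values of [G]
    at an empty set. *)
Lemma telescope2_le_set (R : realType) (T U : finType) (h : T -> R)
    (k : U -> R) (V : zmodType) (G : {set T} -> {set U} -> V) (a : R * R) :
    (forall P, G P finset.set0 = 0) -> (forall E, G finset.set0 E = 0) ->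
  \sum_(p \in down_set a)
    (G (le_set h p.1) (le_set k p.2) - G (lt_set h p.1) (le_set k p.2)
     - G (le_set h p.1) (lt_set k p.2) + G (lt_set h p.1) (lt_set k p.2)) =
  G (le_set h a.1) (le_set k a.2).
Proof.
move=> GP0 G0E.
pose s := undup (codom h); pose r := undup (codom k).
pose A := [seq p <- s | p <= a.1]; pose B := [seq q <- r | q <= a.2].
have jump0 : forall p, p \notin [seq (p, q) | p <- A, q <- B] ->
    p \in down_set a ->
    G (le_set h p.1) (le_set k p.2) - G (lt_set h p.1) (le_set k p.2)
     - G (le_set h p.1) (lt_set k p.2) + G (lt_set h p.1) (lt_set k p.2) = 0.
  move=> [p q] pqN /set_mem [/= pa qa].
  have [->|/le_set_jump[y hy]] := eqVneq (le_set h p) (lt_set h p).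
    by rewrite subrr sub0r addNr.
  have [->|/le_set_jump[z kz]] := eqVneq (le_set k q) (lt_set k q).
    by rewrite addrAC subrK subrr.
  case/negP: pqN; apply/allpairsP; exists (p, q); split=> //=.
    by rewrite mem_filter pa mem_undup -hy codom_f.
  by rewrite mem_filter qa mem_undup -kz codom_f.
rewrite (fsbigE [seq (p, q) | p <- A, q <- B]).
- rewrite big_mkcond /= big_seq (eq_bigr (fun p : R * R =>
    (G (le_set h p.1) (le_set k p.2) - G (lt_set h p.1) (le_set k p.2)) -
    (G (le_set h p.1) (lt_set k p.2) - G (lt_set h p.1) (lt_set k p.2)))).
    rewrite -big_seq big_allpairs big_filter /=.
    transitivity (\sum_(p <- s | p <= a.1)
       (G (le_set h p) (le_set k a.2) - G (lt_set h p) (le_set k a.2))).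
      apply: eq_bigr => p _; rewrite big_filter.
      (* For fixed [p] the sum over the second coordinate collapses first, leaving a one-variable
         sum in [p]. *)
      rewrite (@telescope_le_set _ _ k _
        (fun E => G (le_set h p) E - G (lt_set h p) E)) ?undup_uniq //.
      + by rewrite !GP0 subrr subr0.
      + by move=> y; rewrite mem_undup codom_f.
      + by move=> ? ? /le_trans; apply.
    rewrite (@telescope_le_set _ _ h _ (G^~ (le_set k a.2))) ?undup_uniq //.
    + by rewrite G0E subr0.
    + by move=> y; rewrite mem_undup codom_f.
    + by move=> ? ? /le_trans; apply.
  move=> p /allpairsP[[u v] [/=]]; rewrite !mem_filter.
  move=> /andP[pa _] /andP[qa _] ->; rewrite mem_set //=.
  by rewrite opprD opprK addrA.
- apply: allpairs_uniq; rewrite ?filter_uniq ?undup_uniq //.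
  by move=> [? ?] [? ?].
- move=> p /= /allpairsP[[u v] [/=]]; rewrite !mem_filter.
  by move=> /andP[pa _] /andP[qa _] ->.
- by move=> p /mem_set pa /jump0; apply.
Qed.

(** * Staircases and corner points through finite sets *)

Section Elder.
Variables (R : realType) (X : finMetricType R) (f : X -> R) (lt : rel X).

Definition bounded_step (P : {set X}) (E : {set X * X}) : rel X :=
  fun y z => [&& y \in P, z \in P & (y, z) \in E].

(** Membership in [I_x] as a function of a vertex set and an edge set, so that strict and non-strict
    thresholds can both be substituted. Since [mdist x x = 0], the condition on [(x, x)] encodes
    [0 <= eps], or [0 < eps] for a strict threshold. *)
Definition elder (x : X) (P : {set X}) (E : {set X * X}) : bool :=
  [&& x \in P, (x, x) \in E &
    [forall y, [&& y \in P, connect (bounded_step P E) x y & y != x]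
       ==> lt x y]].

Local Notation dist2 := (fun p : X * X => mdist p.1 p.2).

(** Fewer vertices and edges give a smaller class of [x], in which [x] stays minimal. *)
Lemma elder_sub x (P P' : {set X}) (E E' : {set X * X}) :
  P \subset P' -> E \subset E' -> x \in P -> (x, x) \in E ->
  elder x P' E' -> elder x P E.
Proof.
move=> /fintype.subsetP PP' /fintype.subsetP EE' xP xE.
case/and3P=> _ _ /forallP xmin; rewrite /elder xP xE; apply/forallP => y.
apply/implyP => /and3P[yP xy neq]; apply: (implyP (xmin y)).
rewrite PP' //= neq andbT; apply: connect_sub xy => u v.
by case/and3P=> uP vP uvE; rewrite connect1 // /bounded_step !PP' // EE'.
Qed.

Lemma staircaseE x (p : R * R) :
  (p \in staircase f lt x) = elder x (le_set f p.1) (le_set dist2 p.2).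
Proof.
have stepE : step f p =2 bounded_step (le_set f p.1) (le_set dist2 p.2).
  by move=> y z; rewrite /step /bounded_step !inE.
apply/idP/idP; rewrite inE /=.
  case=> p0; rewrite inE => xp [_ xmin].
  rewrite /elder !inE xp mdistxx p0 /=; apply/forallP => y; apply/implyP.
  rewrite -(eq_connect stepE) => /and3P[yp xy neq].
  by apply: xmin neq; rewrite inE xy andbT; move: yp; rewrite !inE.
rewrite /elder !inE mdistxx => /and3P[xp p0 /forallP xmin]; split=> //.
  by rewrite inE.
split; first by rewrite !inE xp connect0.
move=> y; rewrite !inE => /andP[yp xy] neq; apply: (implyP (xmin y)).
by rewrite !inE yp neq -(eq_connect stepE) xy.
Qed.

(** The indicator is constant for small [t > 0], so [lim] is a true limit here; the same holds for
    the other two directions. *)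
Lemma left_limitE x (p : R * R) : left_limit (staircase f lt x) p =
  (elder x (lt_set f p.1) (le_set dist2 p.2))%:R.
Proof.
apply: lim_near_cst => //.
apply: filterS (near_le_set f p.1) => t tE.
by rewrite indicE staircaseE /= tE subr0.
Qed.

Lemma below_limitE x (p : R * R) : below_limit (staircase f lt x) p =
  (elder x (le_set f p.1) (lt_set dist2 p.2))%:R.
Proof.
apply: lim_near_cst => //.
apply: filterS (near_le_set dist2 p.2) => t tE.
by rewrite indicE staircaseE /= tE subr0.
Qed.

Lemma diag_limitE x (p : R * R) : diag_limit (staircase f lt x) p =
  (elder x (lt_set f p.1) (lt_set dist2 p.2))%:R.
Proof.
apply: lim_near_cst => //.
apply: filterS2 (near_le_set f p.1) (near_le_set dist2 p.2).
by move=> t t1 t2; rewrite indicE staircaseE /= t1 t2.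
Qed.

Lemma sum_corner_indicator x (p : R * R) :
  \sum_(j < 3) (-1) ^+ j * (corner_indicator j (staircase f lt x) p)%:Z =
  (elder x (le_set f p.1) (le_set dist2 p.2))%:Z
  - (elder x (lt_set f p.1) (le_set dist2 p.2))%:Z
  - (elder x (le_set f p.1) (lt_set dist2 p.2))%:Z
  + (elder x (lt_set f p.1) (lt_set dist2 p.2))%:Z.
Proof.
have sf := lt_sub_le_set f p.1; have sd := lt_sub_le_set dist2 p.2.
rewrite !big_ord_recr big_ord0 /= /corner_indicator /corner_point.
rewrite left_limitE below_limitE diag_limitE indicE staircaseE.
set v := elder x (le_set _ _) (le_set _ _).
set l := elder x (lt_set _ _) (le_set _ _).
set b := elder x (le_set _ _) (lt_set _ _).
set d := elder x (lt_set _ _) (lt_set _ _).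
(* In each of the three implications one premise supplies minimality over larger sets and the other
   the memberships required by [elder_sub]. Together they rule out mixed differences of 2 and -2,
   and of 1 away from types 0 and 2. *)
have lb_d : l -> b -> d.
  move=> /[dup] /and3P[xf _ _] le /and3P[_ xd _].
  exact: elder_sub sd xf xd le.
have vd_l : v -> d -> l.
  move=> ve /and3P[xf xd _]; apply: elder_sub ve => //.
  exact: (fintype.subsetP sd).
have vd_b : v -> d -> b.
  move=> ve /and3P[xf xd _]; apply: elder_sub ve => //.
  exact: (fintype.subsetP sf).
have type0 : `[< [/\ v%:R = 1 :> R, l%:R = 0 :> R, b%:R = 0 :> R
      & d%:R = 0 :> R] >] = [&& v, ~~ l, ~~ b & ~~ d].
  apply/asboolP/idP; case: v l b d {lb_d vd_l vd_b} => [] [] [] [] //=;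
    by [case; lra | split].
have type1 : `[< v%:R - l%:R - b%:R + d%:R = -1 :> R >] =
    (v + d + 1 == l + b)%N.
  apply/asboolP/idP; case: v l b d {lb_d vd_l vd_b type0} => [] [] [] [] //=;
    lra.
have type2 : `[< [/\ v%:R = 0 :> R, l%:R = 0 :> R, b%:R = 0 :> R
      & d%:R = 1 :> R] >] = [&& ~~ v, ~~ l, ~~ b & d].
  apply/asboolP/idP; case: v l b d {lb_d vd_l vd_b type0 type1}
    => [] [] [] [] //=; by [case; lra | split].
rewrite type0 type1 type2 {type0 type1 type2}.
by case: v l b d lb_d vd_l vd_b => [] [] [] [] //= lb_d vd_l vd_b;
   do ?[by move: (lb_d isT isT) | by move: (vd_l isT isT)
       | by move: (vd_b isT isT)].
Qed.

(** * Blocks of the treegram and their minimal points *)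

Lemma card_rips_treegram (a : R * R) : strict_total_order lt ->
  #|rips_treegram f a| = #|[set x : X | a \in staircase f lt x]%SET|.
Proof.
move=> [ltxx ltT lt_total]; rewrite /rips_treegram /pi0.
set K := rips a.2 (sublevel f a.1).
have adjE : Defs.adjacent K =2 step f a.
  move=> y z; rewrite /Defs.adjacent /step inE; apply/and3P/and3P.
    move=> [_ /fintype.subsetP yzs /'forall_implyP yz].
    split; rewrite ?yzs ?set21 ?set22 //.
    exact: (implyP (forallP (yz y (set21 _ _)) z) (set22 _ _)).
  (* The bound [0 <= a.2] handles the diagonal pairs in the simplex condition for the edge. *)
  move=> [ys zs yz]; have a0 : 0 <= a.2 by apply: le_trans yz; exact: mdist_ge0.
  split.
  - by apply/set0Pn; exists y; rewrite set21.
  - by apply/fintype.subsetP => u /set2P[] ->.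
  - apply/'forall_implyP => u /set2P[] ->;
    apply/'forall_implyP => w /set2P[] ->;
    by rewrite ?mdistxx // metric_sym.
have vertE : vertices K = [set x in sublevel f a.1 | 0 <= a.2]%SET.
  (* A vertex is a self-adjacent point, as [{x, x} = {x}]. *)
  apply/finset.setP => x; transitivity (Defs.adjacent K x x).
    by rewrite /Defs.adjacent finset.setUid finset.in_set.
  by rewrite adjE /step mdistxx andbA andbb [RHS]finset.in_set.
pose C x := [set y in vertices K | connect (Defs.adjacent K) x y]%SET.
have CE x : 0 <= a.2 -> C x = chain_class f a x.
  move=> a0; apply/finset.setP => y.
  by rewrite /C vertE !finset.in_set a0 andbT (eq_connect adjE).
have CV x : x \in vertices K -> [/\ 0 <= a.2, x \in sublevel f a.1 & x \in C x].
  move=> xV; have := xV; rewrite vertE finset.in_set => /andP[xs a0].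
  by split=> //; rewrite /C finset.in_set xV connect0.
have symc : connect_sym (Defs.adjacent K).
  by apply: sym_connect_sym => x y; rewrite /Defs.adjacent finset.setUC.
have Ceq x y : y \in C x -> C y = C x.
  rewrite finset.in_set => /andP[_ xy]; apply/finset.setP => z.
  by rewrite !finset.in_set (same_connect symc xy).
have -> : equivalence_partition (connect (Defs.adjacent K)) (vertices K) =
    [set C x | x in [set x | a \in staircase f lt x]%SET]%SET.
  apply/finset.setP => B; apply/imsetP/imsetP => -[x].
    move=> /CV[a0 _ xC] ->.
    (* The minimum of the block is found as the point with fewest predecessors in it: some [y]
       before [m] would have strictly fewer, by transitivity and irreflexivity. *)
    pose below y := #|[set z in C x | lt z y]%SET|.
    case: (@arg_minnP _ x (mem (C x)) below xC) => m /= mC mmin.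
    exists m; last by rewrite (Ceq _ _ mC).
    have mV : m \in vertices K by move: mC; rewrite finset.in_set => /andP[].
    have [_ ms mm] := CV _ mV.
    rewrite finset.in_set inE /=; split=> //.
    rewrite -CE // /is_min; split=> //.
    move=> y; rewrite (Ceq _ _ mC) => yC neq.
    case/orP: (lt_total _ _ neq) => // ym.
    have := mmin _ yC; rewrite leqNgt => /negP[]; apply: proper_card.
    apply/properP; split.
      apply/fintype.subsetP => z; rewrite !finset.in_set => /andP[-> zy] /=.
      exact: ltT ym.
    by exists y; rewrite finset.in_set yC ?ltxx //=.
  rewrite finset.in_set inE /= => -[a0 xs _] ->.
  by exists x => //; rewrite vertE finset.in_set xs.
(* Two distinct minimal points of one block would precede each other. *)
apply: card_in_imset => x y; rewrite !finset.in_set !inE /=.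
move=> [a0 _]; rewrite -CE // => -[xC xmin] [_ _]; rewrite -CE // => -[yC ymin].
move=> Cxy; apply/eqP/negPn/negP => neq.
have xy : lt x y by apply: xmin; rewrite ?Cxy // eq_sym.
have yx : lt y x by apply: ymin; rewrite -?Cxy.
by have := ltT _ _ _ xy yx; rewrite ltxx.
Qed.

End Elder.

Theorem theorem4p9 (R : realType) (X : finMetricType R) (f : X -> R)
    (lt : rel X) (lt_total : strict_total_order lt)
    (lt_compat : compatible f lt) (a : R * R) :
  #|rips_treegram f a| = #|[set x : X | a \in staircase f lt x]%SET| /\
  (#|[set x : X | a \in staircase f lt x]%SET|%:Z =
    \sum_(p \in down_set a) \sum_(j < 3) (-1) ^+ j * (feature f lt j p)%:Z).
Proof.
split; first exact: card_rips_treegram.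
(* [G] counts the points that are minimal in their class; its mixed difference at [p] is the
   alternating sum of the features there. *)
pose G P E : int := \sum_(x : X) (elder lt x P E)%:Z.
have GP0 P : G P finset.set0 = 0.
  by rewrite /G big1 // => x _; rewrite /elder inE andbF.
have G0E E : G finset.set0 E = 0.
  by rewrite /G big1 // => x _; rewrite /elder inE.
transitivity (G (le_set f a.1) (le_set (fun p : X * X => mdist p.1 p.2) a.2)).
  rewrite -sum1dep_card big_mkcond /= -natz natr_sum.
  by apply: eq_bigr => x _; rewrite staircaseE; case: elder.
rewrite -telescope2_le_set //; apply: eq_fsbigr => p _.
under [RHS]eq_bigr do rewrite /feature -natz natr_sum mulr_sumr.
rewrite exchange_big /G -!sumrB -big_split /=; apply: eq_bigr => x _.
under [RHS]eq_bigr do rewrite natz.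
by rewrite sum_corner_indicator.
Qed.
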